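(* Let $d$ be a nonnegative integer. Let $A$ (resp. $A^*$) be a diagonalizable linear transformation on $V$ with eigenvalues $\{\theta_i\}_{i=0}^d$ (resp. $\{\theta^*_i\}_{i=0}^d$). Suppose that there exists an $(A,A^* )$-split decomposition of $V$ with respect to $(\{\theta_i\}_{i=0}^d;\{\theta^*_i\}_{i=0}^d)$. Then the pair $(A,A^* )$ is Hessenberg with respect to $(\{\theta_i\}_{i=0}^d;\{\theta^*_i\}_{i=0}^d)$.
   Context: $\mathbb K$ is a field and $V$ is a nonzero finite-dimensional vector space over $\mathbb K$. A linear transformation on $V$ is a $\mathbb K$-linear map $V\to V$; it is diagonalizable if $V$ is spanned by its eigenspaces. $A$ and $A^*$ are arbitrary linear transformations ($A^*$ does not denote an adjoint or conjugate-transpose). Saying that $A$ has eigenvalues $\{\theta_i\}_{i=0}^d$ means that $\theta_0,\dots,\theta_d$ is an ordering, without repetition, of all the distinct eigenvalues of $A$; similarly for $A^*$. Hessenberg: let $V_i$ be the eigenspace of $A$ for $\theta_i$ and $V^*_i$ the eigenspace of $A^*$ for $\theta^*_i$ ($0\le i\le d$), and set $V_{d+1}=0$, $V^*_{d+1}=0$. The pair $(A,A^* )$ is Hessenberg with respect to $(\{\theta_i\}_{i=0}^d;\{\theta^*_i\}_{i=0}^d)$ if for all $0\le i\le d$ both $A^*V_i\subseteq V_0+V_1+\cdots+V_{i+1}$ and $AV^*_i\subseteq V^*_0+V^*_1+\cdots+V^*_{i+1}$. Split decomposition: a decomposition of $V$ is a sequence $\{U_i\}_{i=0}^d$ of nonzero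 subspaces of $V$ such that $V=U_0+U_1+\cdots+U_d$ is a direct sum; set $U_{-1}=0$, $U_{d+1}=0$. An $(A,A^* )$-split decomposition of $V$ with respect to $(\{\theta_i\}_{i=0}^d;\{\theta^*_i\}_{i=0}^d)$ is a decomposition $\{U_i\}_{i=0}^d$ of $V$ such that for all $0\le i\le d$ both $(A-\theta_{d-i}I)U_i\subseteq U_{i+1}$ and $(A^*-\theta^*_iI)U_i\subseteq U_{i-1}$. *)

(* Defs.v *)
From mathcomp Require Import all_boot all_order all_algebra.

Set Implicit Arguments.
Unset Strict Implicit.
Unset Printing Implicit Defensive.

Import GRing.Theory.

Local Open Scope ring_scope.

Section LinearTransformations.

Variables (K : fieldType) (V : vectType K) (d : nat).

Implicit Types (A As : 'End(V)) (theta thetas : 'I_d.+1 -> K).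
Implicit Types (W U : 'I_d.+1 -> {vspace V}).

(* As V is finite-dimensional, finitely many eigenspaces suffice to span it;
   scalars in s that are not eigenvalues contribute the zero subspace. *)
Definition diagonalizable_end A : Prop :=
  exists s : seq K, (\sum_(a <- s) passmx.leigenspace A a)%VS = {:V}%VS.

Definition has_eigenvalues A theta : Prop :=
  injective theta /\ forall a : K, passmx.leigenvalue A a <-> exists i, theta i = a.

(* The families below are extended by zero outside {0, ..., d}:
   vnth W k is W_k, with W_k = 0 for k > d, and
   vprev W k is W_(k-1), with W_(-1) = 0. *)
Definition vnth W (k : nat) : {vspace V} :=
  if insub k is Some i then W i else 0%VS.

Definition vprev W (k : nat) : {vspace V} :=
  if k is k'.+1 then vnth W k' else 0%VS.

Definition hessenberg A As theta thetas : Prop :=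
  let E i := passmx.leigenspace A (theta i) in
  let Es i := passmx.leigenspace As (thetas i) in
  forall i : 'I_d.+1,
    (As @: E i <= \sum_(0 <= j < i.+2) vnth E j)%VS /\
    (A @: Es i <= \sum_(0 <= j < i.+2) vnth Es j)%VS.

Definition decomposition U : Prop :=
  [/\ forall i, U i != 0%VS,
      (\sum_i U i)%VS = {:V}%VS &
      directv (\sum_i U i)].

Definition split_decomposition A As theta thetas U : Prop :=
  decomposition U /\
  forall i : 'I_d.+1,
    ((A - theta (rev_ord i) *: \1%VF) @: U i <= vnth U i.+1)%VS /\
    ((As - thetas i *: \1%VF) @: U i <= vprev U i)%VS.

End LinearTransformations.

(* Main.v *)
(** Both eigenspace flags are flags of the split decomposition: if
    [(B - t i) W_i] lies in [W_0 + ... + W_(i-1)] for all [i], the [t i] are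
    distinct and the [W_i] span [V], then for every [k] the first [k]
    eigenspaces of [B] have the same sum as the first [k] subspaces [W_i].
    Apply this to [B := As] with [W_i := U_i] and to [B := A] with
    [W_i := U_(d-i)]; the other map raises each of these flags by at most one
    step. *)
Require Import Defs.
From mathcomp Require Import all_boot all_order all_algebra zify.

Set Implicit Arguments.
Unset Strict Implicit.
Unset Printing Implicit Defensive.

Import GRing.Theory.

Local Open Scope ring_scope.

Section Flags.

Variables (K : fieldType) (V : vectType K) (d : nat).

Implicit Types (A B C : 'End(V)) (W : 'I_d.+1 -> {vspace V}).

Definition flag W (k : nat) : {vspace V} := (\sum_(j < d.+1 | (j < k)%N) W j)%VS.

Lemma flag_sup W (j : 'I_d.+1) k : (j < k)%N -> (W j <= flag W k)%VS.
Proof. by move=> ltjk; apply: sumv_sup (subvv _). Qed.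

Lemma flagS W k l : (k <= l)%N -> (flag W k <= flag W l)%VS.
Proof.
by move=> lekl; apply/subv_sumP => j ltjk; apply/flag_sup/(leq_trans ltjk).
Qed.

Lemma flag_full W k : (d < k)%N -> flag W k = (\sum_j W j)%VS.
Proof.
by move=> ltdk; apply: eq_bigl => j; rewrite (leq_trans (ltn_ord j)).
Qed.

Lemma vnth_ord W (j : 'I_d.+1) : vnth W j = W j.
Proof. by rewrite /vnth valK. Qed.

Lemma flag_sub_vnth W k : (flag W k <= \sum_(0 <= j < k) vnth W j)%VS.
Proof.
apply/subv_sumP => j ltjk; rewrite big_mkord.
by apply: (sumv_sup (Ordinal ltjk)) => //=; rewrite vnth_ord.
Qed.

Lemma vnth_sub W (k : nat) (X : {vspace V}) :
  (forall j : 'I_d.+1, j = k :> nat -> (W j <= X)%VS) -> (vnth W k <= X)%VS.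
Proof. by rewrite /vnth; case: insubP => [j _ eqj|_ _]; [apply | apply: sub0v]. Qed.

Lemma limg_flag_sub C W k (X : {vspace V}) :
  (forall j : 'I_d.+1, (j < k)%N -> (C @: W j <= X)%VS) -> (C @: flag W k <= X)%VS.
Proof. by move=> sCX; rewrite limg_sum; apply/subv_sumP. Qed.

Lemma shift_lfunE B (a : K) v : (B - a *: \1%VF) v = B v - a *: v.
Proof. by rewrite add_lfunE opp_lfunE scale_lfunE id_lfunE. Qed.

Lemma mem_leigenspace B (a : K) v :
  (v \in passmx.leigenspace B a) = (B v == a *: v).
Proof. by rewrite memv_ker shift_lfunE subr_eq0. Qed.

(** For [v] in [X], [B v] is [(B - a) v] plus [a v], and both summands lie in [Y]. *)
Lemma limg_shift_sub B (a : K) (X Y : {vspace V}) :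
  (X <= Y)%VS -> ((B - a *: \1%VF) @: X <= Y)%VS -> (B @: X <= Y)%VS.
Proof.
move=> sXY sBXY; apply/subvP => _ /memv_imgP[v Xv ->].
rewrite -(subrK (a *: v) (B v)) -shift_lfunE rpredD //.
  by apply: (subvP sBXY); apply: memv_img.
by rewrite rpredZ // (subvP sXY).
Qed.

Section Triangular.

Variables (B : 'End(V)) (t : 'I_d.+1 -> K) (W : 'I_d.+1 -> {vspace V}).
Hypothesis t_inj : injective t.
Hypothesis W_full : (\sum_i W i)%VS = {:V}%VS.
Hypothesis B_tri : forall i, ((B - t i *: \1%VF) @: W i <= flag W i)%VS.

Let E i := passmx.leigenspace B (t i).

(** On [W i] this is [B_tri]; on an earlier [W j], [B - t i] differs from [B - t j] by a scalar, so
    it stays inside [flag W i]. *)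
Lemma shift_flag_sub (i : 'I_d.+1) :
  ((B - t i *: \1%VF) @: flag W i.+1 <= flag W i)%VS.
Proof.
apply: limg_flag_sub => j; rewrite ltnS leq_eqVlt => /orP[/eqP/val_inj-> //|ltji].
apply: (limg_shift_sub (a := t j - t i)); first exact: flag_sup.
rewrite -addrA -opprD -scalerDl [t i + _]addrC subrK.
exact: subv_trans (B_tri j) (flagS _ (ltnW ltji)).
Qed.

(* For v in E_i and k > i, (B - t_k) v is a nonzero multiple of v, so v can be
   pushed down the flag from step k+1 to step k. *)
Lemma eigenspace_sub_flag i : (E i <= flag W i.+1)%VS.
Proof.
apply/subvP => v; rewrite mem_leigenspace => /eqP Bv.
(* The descent starts at the full flag and stops at step [i.+1]: going further would require
   dividing by [t i - t i]. *)
suff descent n : (n <= d - i)%N -> v \in flag W (d.+1 - n).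
  by have := descent _ (leqnn _); rewrite subSn ?leq_subr // subKn // -ltnS.
elim: n => [|n IHn] len; first by rewrite subn0 flag_full // W_full memvf.
have ltnd : (n <= d)%N by rewrite (leq_trans (ltnW len)) ?leq_subr.
have ltkd : (d - n < d.+1)%N by rewrite ltnS leq_subr.
have ltik : (i < d - n)%N by rewrite ltn_subRL addnC -ltn_subRL.
have := IHn (ltnW len); rewrite subSS subSn // => vF.
have := subvP (shift_flag_sub (Ordinal ltkd)) _ (memv_img _ vF).
rewrite shift_lfunE Bv -scalerBl rpredZeq subr_eq0 => /predU1P[/t_inj eqik|//].
by move: ltik; rewrite eqik ltnn.
Qed.

(** By induction, [B - t i] maps [w] in [W i] into the sum of the earlier eigenspaces. As the [t j]
    are distinct, [B - t i] is invertible on that sum, so [w] is an element of it plus a vector of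
    [E i]. *)
Lemma flag_sub_eigenspaces k : (flag W k <= flag E k)%VS.
Proof.
elim: k => [|k IHk]; first by rewrite /flag big_pred0 ?sub0v.
apply/subv_sumP => i; rewrite ltnS leq_eqVlt => /predU1P[eqik|ltik]; last first.
  exact: subv_trans (flag_sup _ ltik) (subv_trans IHk (flagS _ (leqnSn k))).
apply/subvP => w Ww; rewrite -{}eqik in IHk *.
have /memv_sumP[e Ee def_e] := subvP (subv_trans (B_tri i) IHk) _ (memv_img _ Ww).
(* u is the preimage of (B - t_i) w inside E_0 + ... + E_(i-1). *)
pose u := \sum_(j < d.+1 | (j < i)%N) (t j - t i)^-1 *: e j.
have Eu : u \in flag E i by apply: memv_sumr => j ltji; rewrite rpredZ ?Ee.
rewrite -(subrK u w) rpredD ?(subvP (flagS _ (leqnSn i)) _ Eu) //.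
apply: (subvP (flag_sup _ (ltnSn i))).
rewrite memv_ker linearB /= def_e subr_eq0; apply/eqP.
rewrite linear_sum; apply: eq_bigr => j ltji.
have := Ee j ltji; rewrite mem_leigenspace => /eqP Bej.
rewrite linearZ /= shift_lfunE Bej -scalerBl scalerA mulVf ?scale1r //.
by rewrite subr_eq0 (inj_eq t_inj) -val_eqE /= neq_ltn ltji.
Qed.

(** Pass from [E i] to the flag of [W], let [C] raise it one step, and return to the flag of [E]. *)
Lemma limg_eigenspace_sub C :
    (forall i : 'I_d.+1, (C @: W i <= flag W i.+2)%VS) ->
  forall i : 'I_d.+1, (C @: E i <= \sum_(0 <= j < i.+2) vnth E j)%VS.
Proof.
move=> C_hess i; apply: subv_trans (flag_sub_vnth _ _).
apply: subv_trans (flag_sub_eigenspaces _).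
apply: subv_trans (limgS _ (eigenspace_sub_flag i)) _.
by apply: limg_flag_sub => j leji; apply: subv_trans (C_hess j) (flagS _ _).
Qed.

End Triangular.

End Flags.

Theorem theorem1p8 (K : fieldType) (V : vectType K)
    (V_neq0 : ({:V} != 0)%VS) (d : nat) (A As : 'End(V))
    (theta thetas : 'I_d.+1 -> K)
    (A_diag : diagonalizable_end A) (A_eig : has_eigenvalues A theta)
    (As_diag : diagonalizable_end As) (As_eig : has_eigenvalues As thetas)
    (split_ex : exists U : 'I_d.+1 -> {vspace V},
       split_decomposition A As theta thetas U) :
  hessenberg A As theta thetas.
Proof.
have [[theta_inj _] [thetas_inj _]] := (A_eig, As_eig).
have [U [[_ U_full _] U_split]] := split_ex.
(* [A] moves [U] upwards, so it is triangular for the reversed order, where the shift on [W i]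
   becomes [theta i]. *)
pose W i := U (rev_ord i).
have W_full : (\sum_i W i)%VS = {:V}%VS.
  by rewrite -U_full [RHS](reindex_inj rev_ord_inj).
have A_U i : ((A - theta (rev_ord i) *: \1%VF) @: U i <= flag U i.+2)%VS.
  apply: subv_trans (U_split i).1 _.
  by apply: vnth_sub => j eqj; apply: flag_sup; rewrite eqj.
have As_U (i : 'I_d.+1) : ((As - thetas i *: \1%VF) @: U i <= flag U i)%VS.
  apply: subv_trans (U_split i).2 _; case: (nat_of_ord i) => [|k]; first exact: sub0v.
  by apply: vnth_sub => j eqj; apply: flag_sup; rewrite eqj.
have A_W (i : 'I_d.+1) : ((A - theta i *: \1%VF) @: W i <= flag W i)%VS.
  have := (U_split (rev_ord i)).1; rewrite rev_ordK => /subv_trans; apply.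
  apply: vnth_sub => j eqj; rewrite -[j]rev_ordK; apply: (flag_sup W).
  by rewrite /=; move: eqj => /=; have := ltn_ord j; lia.
have As_W (i : 'I_d.+1) : ((As - thetas (rev_ord i) *: \1%VF) @: W i <= flag W i.+2)%VS.
  apply: subv_trans (U_split (rev_ord i)).2 _ => /=.
  (* The index of [rev_ord i] is [d - i]; it is zero for [i = d], where the target is the zero
     space. *)
  rewrite /vprev; case eqk: (d.+1 - i.+1)%N => [|k]; first exact: sub0v.
  apply: vnth_sub => j eqj; rewrite -[j]rev_ordK; apply: (flag_sup W).
  by rewrite /=; lia.
move=> i; split.
(* The eigenspaces of [A] follow [W], which [As] raises; those of [As] follow [U], which [A]
   raises. *)
- apply: (limg_eigenspace_sub theta_inj W_full A_W) => {}i.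
  exact: limg_shift_sub (flag_sup _ _) (As_W i).
- apply: (limg_eigenspace_sub thetas_inj U_full As_U) => {}i.
  exact: limg_shift_sub (flag_sup _ _) (A_U i).
Qed.
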